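(* Let $0<p<1$, $q=1-p$. Consider the full-information duration problem (stopping only at relatively best observations) with random horizon $N$ having the geometric distribution $P(N=k)=pq^{k-1}$, $k=1,2,\ldots$, as described in the context. (a) If $p\le e^{-1}$, put $x_0=\frac{1-ep}{q}$. Then $x_0\in[0,1)$, and $\{(k,x): x\ge x_0\}$ is the optimal stopping region (i.e. it is optimal to stop at the first $k\le N$ such that $X_k=\max\{X_1,\ldots,X_k\}\ge x_0$). The optimal expected payoff is $$v^\star=\frac{x_0}{1-qx_0}-\frac1q\ln\frac{1-q}{1-qx_0}.$$ (b) If $p>e^{-1}$, then the optimal stopping region is the whole state space $\{(k,x): k\ge 1,\ 0<x<1\}$; that is, it is optimal to stop at the first observation, and the optimal expected payoff is $$v^\star=-\frac1q\ln(1-q).$$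
   Context: Let $X_1,X_2,\ldots$ be i.i.d. random variables uniformly distributed on $[0,1]$ and let $N$ be a random variable with values in $\{1,2,\ldots\}$ independent of $(X_n)$. The observation $X_k$ is available only if $N\ge k$; the decision maker observes $X_1,X_2,\ldots$ sequentially and at stage $k$ knows $X_1,\ldots,X_k$ and whether $N\ge k$ (stopping times are with respect to this information). The distributions of the $X_i$ and of $N$ are known. The observation $X_k$ (with $k\le N$) is a candidate if $X_k=\max\{X_1,\ldots,X_k\}$; the process is then said to be in state $(k,x)$ with $x=X_k$. Only candidates may be selected, and without recall (a candidate must be selected at the moment it is observed or not at all). If the decision maker stops in state $(k,x)$, the payoff is the duration, i.e. the length of time during which the selected object remains relatively best up to the horizon: $$1+\sum_{i=k+1}^{N}\prod_{j=k+1}^{i}\mathbf 1_{\{X_j<x\}}.$$ Its conditional expectation given state $(k,x)$ is the expected payoff for stopping in that state. If no candidate is selected by time $N$, the payoff is $0$. The objective is to maximize the expected payoff over all stopping times; $v^\star$ denotes the supremum of the expected payoff at the start of the process. The optimal stopping region is a set of states $(k,x)$ such that the rule which stops at the first candidate whose state lies in this set is optimal. *)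

(* Defs.v *)
From HB Require Import structures.
From mathcomp Require Export all_boot all_order all_algebra.
From mathcomp Require Export finmap.
From mathcomp Require Export all_classical all_reals all_analysis.

Set Implicit Arguments.
Unset Strict Implicit.
Unset Printing Implicit Defensive.

Import Order.TTheory GRing.Theory Num.Theory.

Local Open Scope classical_set_scope.
Local Open Scope ring_scope.

(* Throughout, observations and stages are numbered from 1; [X 0] is never
   used, and no hypothesis is made on it. *)

Definition independent_RVs d (T : measurableType d) (R : realType)
    (P : probability T R) (I : set nat) (X : nat -> {RV P >-> R}) : Prop :=
  forall (J : {fset nat}) (A : nat -> set R), [set` J] `<=` I ->
    (forall i, i \in J -> measurable (A i)) ->
    P (\bigcap_(i in [set` J]) (X i @^-1` A i)) =
      (\prod_(i <- J) P (X i @^-1` A i))%E.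

Definition sigma_RVs d (T : measurableType d) (R : realType)
    (P : probability T R) (I : set nat) (X : nat -> {RV P >-> R}) :
    set (set T) :=
  <<s \bigcup_(i in I) preimage_set_system setT (X i) measurable >>.

Definition independent_of_RVs d (T : measurableType d) (R : realType)
    (P : probability T R) (N : {RV P >-> nat}) (I : set nat)
    (X : nat -> {RV P >-> R}) : Prop :=
  forall (A : set T) (B : set nat), sigma_RVs I X A ->
    P (A `&` N @^-1` B) = (P A * P (N @^-1` B))%E.

(* The law is compared on Borel sets only: a measure is a function on all
   sets, whose values on nonmeasurable sets are irrelevant. *)
Definition uniform01 d (T : measurableType d) (R : realType)
    (P : probability T R) (Y : {RV P >-> R}) : Prop :=
  forall A : set R, measurable A ->
    distribution P Y A = uniform_prob (@ltr01 R) A.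

Definition geometric_RV d (T : measurableType d) (R : realType)
    (P : probability T R) (p : R) (N : {RV P >-> nat}) : Prop :=
  forall k : nat, (1 <= k)%N ->
    P (N @^-1` [set k]) = (p * (1 - p) ^+ k.-1)%:E.

(* Information at stage k: X_1, ..., X_k and, for each i <= k, whether
   N >= i. *)
Definition information d (T : measurableType d) (R : realType)
    (P : probability T R) (X : nat -> {RV P >-> R}) (N : {RV P >-> nat})
    (k : nat) : set (set T) :=
  <<s (\bigcup_(i in [set i | (1 <= i <= k)%N])
         preimage_set_system setT (X i) measurable) `|`
      [set [set w | (i <= N w)%N] | i in [set i | (1 <= i <= k)%N]] >>.

Definition candidate d (T : measurableType d) (R : realType)
    (P : probability T R) (X : nat -> {RV P >-> R}) (N : {RV P >-> nat})
    (k : nat) (w : T) : Prop :=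
  (1 <= k <= N w)%N /\ (forall j : nat, (1 <= j <= k)%N -> X j w <= X k w).

(* [tau w = None] means that nothing is selected. *)
Definition selection_rule d (T : measurableType d) (R : realType)
    (P : probability T R) (X : nat -> {RV P >-> R}) (N : {RV P >-> nat})
    (tau : T -> option nat) : Prop :=
  (forall k : nat, information X N k (tau @^-1` [set Some k])) /\
  (forall (w : T) (k : nat), tau w = Some k -> candidate X N k w).

Definition duration d (T : measurableType d) (R : realType)
    (P : probability T R) (X : nat -> {RV P >-> R}) (N : {RV P >-> nat})
    (k : nat) (w : T) : R :=
  1 + \sum_(k.+1 <= i < (N w).+1)
        \prod_(k.+1 <= j < i.+1) (X j w < X k w)%R%:R.

Definition payoff d (T : measurableType d) (R : realType)
    (P : probability T R) (X : nat -> {RV P >-> R}) (N : {RV P >-> nat})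
    (tau : T -> option nat) (w : T) : R :=
  if tau w is Some k then duration X N k w else 0.

Definition expected_payoff d (T : measurableType d) (R : realType)
    (P : probability T R) (X : nat -> {RV P >-> R}) (N : {RV P >-> nat})
    (tau : T -> option nat) : \bar R :=
  'E_P[payoff X N tau].

Definition optimal_value d (T : measurableType d) (R : realType)
    (P : probability T R) (X : nat -> {RV P >-> R}) (N : {RV P >-> nat}) :
    \bar R :=
  ereal_sup [set expected_payoff X N tau | tau in selection_rule X N].

Definition optimal_rule d (T : measurableType d) (R : realType)
    (P : probability T R) (X : nat -> {RV P >-> R}) (N : {RV P >-> nat})
    (tau : T -> option nat) : Prop :=
  selection_rule X N tau /\ expected_payoff X N tau = optimal_value X N.

Definition stop_at_first d (T : measurableType d) (R : realType)
    (P : probability T R) (X : nat -> {RV P >-> R}) (N : {RV P >-> nat})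
    (S : set (nat * R)) (w : T) : option nat :=
  ohead [seq k <- iota 1 (N w) | `[< candidate X N k w /\ S (k, X k w) >]].

Definition optimal_stopping_region d (T : measurableType d) (R : realType)
    (P : probability T R) (X : nat -> {RV P >-> R}) (N : {RV P >-> nat})
    (S : set (nat * R)) : Prop :=
  optimal_rule X N (stop_at_first X N S).

(* Main.v *)
From HB Require Import structures.
Require Import Defs.
From mathcomp Require Import measurable_realfun ring lra.

Set Implicit Arguments.
Unset Strict Implicit.
Unset Printing Implicit Defensive.

Import Order.TTheory GRing.Theory Num.Theory.
Import numFieldNormedType.Exports.

Local Open Scope classical_set_scope.
Local Open Scope ring_scope.

(** Survival is memoryless: from any stage that is reached, the next one is
    reached with probability [q = 1 - p].  A selected object of value [x] is
    still best and the process still running [i] stages later with probability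
    [(q x)^i], so that stopping in state [(k, x)] is worth [1 / (1 - q x)],
    whatever [k].

    Let [c = x0] when [p <= 1/e] and [c = 0] otherwise, and
    [G(m) = 1 / (1 - q max(c, m))] ([hold q c]).  Then [G] dominates the reward
    for stopping, and at the running maximum it is superharmonic for the
    process killed with probability [p] at each stage: if [U] is uniform and
    [t = max(c, m)], then
      [q E G(max(m, U)) = q t G(m) + ln ((1 - q t) / (1 - q))],
    and as [G(m) = q t G(m) + 1], the right-hand side is at most [G(m)] as
    soon as [1 - q t <= e (1 - q)], that is, [t >= x0].  For [m <= c = x0] it
    equals [G(m)] ([hold_superharmonic], [hold_harmonic]).  So no rule can
    expect more than [E G(X_1)], which is the announced value.

    The supermartingale argument is carried out on two events at each stage
    [i <= N]: [waiting i], nothing has been selected yet, and [held i], the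
    selected object is still best.  The payoff is the number of stages at
    which [held] occurs ([payoff_held]).  With [M_i] the running maximum, let
    the potential at stage [i] be the integral of [G(M_i)] over [waiting i]
    plus that of [1 / (1 - q M_i)] over [held i].  From [i] to [i + 1] it drops
    by at least [P (held i)] ([potential_step]): on [held i] this is the
    identity [g(x) = 1 + q x g(x)] for [g(x) = 1 / (1 - q x)]
    ([held_balance]), on [waiting i] the superharmonicity of [G]
    ([waiting_step_le]).  Summing over [i] bounds every expected payoff by
    the initial potential, hence by [E G(X_1)] ([expected_payoff_le]).

    The rules of the theorem lose nothing on the way: they select only where
    [G] is the reward for stopping, and while they wait the running maximum is
    at most [c], where [G] is harmonic, unless waiting is a null event.  Since
    the potential is [O(q^i)], the bound is attained ([expected_payoff_eq]).

    Conditioning on the past enters only through [integral_step]: on an event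
    known at stage [i], the next observation can be integrated out separately
    from the running maximum. *)

(** * Integrating out an independent variable *)

Section freeze.
Local Open Scope ereal_scope.

Lemma ge0_integral_mrestr d (T : measurableType d) (R : realType)
    (mu : {measure set T -> \bar R}) (D : set T) (mD : measurable D)
    (f : T -> \bar R) : measurable_fun [set: T] f -> (forall x, 0 <= f x) ->
  \int[mrestr mu mD]_x f x = \int[mu]_(x in D) f x.
Proof.
move=> mf f0.
have D0 : mrestr mu mD (~` D) = 0 by rewrite /mrestr setICl measure0.
rewrite (@ge0_negligible_integral _ _ _ _ setT (~` D))//; last exact: measurableC.
rewrite setTD setCK; apply: eq_measure_integral => A mA AD.
transitivity (mu (A `&` D)); [by []|by rewrite setIidl].
Qed.

(** The factorization says that, under [P] restricted to [D `&` E], the law of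
    [(Y, U)] is [q] times the law of [Y] under [P] restricted to [D], times
    [Q]; the integral is then given by Tonelli's theorem for this product.
    Independence is asked only on [D] and only of [Y], since the stages of the
    problem supply no more than that. *)
Lemma freezing d d1 d2 (T : measurableType d) (T1 : measurableType d1)
    (T2 : measurableType d2) (R : realType) (P : {finite_measure set T -> \bar R})
    (Q : probability T2 R) (D E : set T) (Y : T -> T1) (U : T -> T2) (q : R)
    (phi : T1 * T2 -> \bar R) :
  measurable D -> measurable E -> measurable_fun [set: T] Y ->
  measurable_fun [set: T] U -> (0 <= q)%R ->
  (forall A B, measurable A -> measurable B ->
    P (D `&` E `&` (Y @^-1` A `&` U @^-1` B)) = q%:E * P (D `&` Y @^-1` A) * Q B) ->
  measurable_fun [set: T1 * T2] phi -> (forall z, 0 <= phi z) ->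
  \int[P]_(w in D `&` E) phi (Y w, U w) =
    q%:E * \int[P]_(w in D) \int[Q]_u phi (Y w, u).
Proof.
move=> mD mE mY mU q0 PDE mphi phi0.
have mDE : measurable (D `&` E) by exact: measurableI.
have mYU : measurable_fun setT (fun w => (Y w, U w)) by exact/measurable_fun_pair.
pose YD : {measure set T1 -> \bar R} :=
  measure_function_pushforward__canonical__measure_function_Measure (mrestr P mD) mY.
pose qYD : {measure set T1 -> \bar R} := mscale (NngNum q0) YD.
have qYD_fin : fin_num_fun qYD.
  move=> A mA; rewrite /qYD /= /mscale /= fin_numM// /pushforward /mrestr.
  apply: fin_num_measure; apply: measurableI => //.
  by rewrite -[X in measurable X]setTI; apply (mY measurableT A mA).
pose m1 : {finite_measure set T1 -> \bar R} :=
  HB.pack (Measure.sort qYD) (Measure_isFinite.Build _ _ _ qYD qYD_fin).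
pose nu : {measure set (T1 * T2) -> \bar R} :=
  measure_function_pushforward__canonical__measure_function_Measure (mrestr P mDE) mYU.
have prodE X : measurable X -> (m1 \x Q) X = nu X.
  apply: product_measure_unique => A B mA mB.
  rewrite /= /mscale /= /pushforward /mrestr /=.
  rewrite [X in P X](_ : _ = D `&` E `&` (Y @^-1` A `&` U @^-1` B));
    last by rewrite setIC.
  by rewrite PDE// (setIC D).
transitivity (\int[nu]_z phi z).
  rewrite [RHS](ge0_integral_pushforward mYU (mrestr P mDE) measurableT mphi);
    last by move=> ? _; exact: phi0.
  rewrite preimage_setT [RHS](ge0_integral_mrestr _ mDE)//;
    last by move=> ?; exact: phi0.
  exact: measurableT_comp.
transitivity (\int[m1 \x Q]_z phi z).
  by apply: eq_measure_integral => A mA _; apply/esym; exact: prodE.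
have mphiF := measurable_fun_fubini_tonelli_F (m2 := Q) _ mphi phi0.
have phiF0 (y : T1) : 0 <= \int[Q]_u phi (y, u) by exact: integral_ge0.
rewrite fubini_tonelli1// /m1 /= ge0_integral_mscale//=;
  last by move=> y _; exact: phiF0.
congr (_ * _); rewrite (ge0_integral_pushforward mY (mrestr P mD) measurableT mphiF);
    last by move=> ? _; exact: phiF0.
rewrite preimage_setT (ge0_integral_mrestr _ mD)//; last by move=> ?; exact: phiF0.
exact: measurableT_comp.
Qed.

End freeze.

(** * The value of holding an object *)

Section calculus.
Context (R : realType) (q : R).
Hypothesis q01 : 0 < q < 1.

Lemma integral_inv_affine (t : R) : 0 <= t < 1 ->
  (\int[lebesgue_measure]_(x in `[t, 1%R]) ((1 - q * x)^-1)%:E =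
    (q^-1 * ln ((1 - q * t) / (1 - q)))%:E)%E.
Proof.
move=> /andP[t0 t1].
have /andP[q0 q1] := q01.
have pos x : x <= 1 -> 0 < 1 - q * x by move=> ?; nra.
pose F (x : R) : R := - q^-1 * ln (1 - q * x).
have dF (x : R) : x <= 1 -> is_derive x 1 F (1 - q * x)^-1.
  move=> x1; have := pos x x1 => x0.
  have dln := is_derive1_ln x0.
  rewrite /F.
  have daff : is_derive x 1 (fun x : R => 1 - q * x) (- q).
    by apply: is_derive_eq; rewrite /GRing.scale /=; ring.
  have dlog : is_derive x 1 (@ln R \o (fun x => 1 - q * x))
      ((1 - q * x)^-1 * - q) by exact: is_derive1_comp.
  have dscaled : is_derive x 1 (- q^-1 *: (@ln R \o (fun x => 1 - q * x)))
      (- q^-1 *: ((1 - q * x)^-1 * - q)) by exact: is_deriveZ.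
  apply: is_derive_eq dscaled _; rewrite /GRing.scale /= mulrCA mulrNN mulVf ?mulr1//.
  by rewrite gt_eqF.
have cF (x : R) : x <= 1 -> {for x, continuous F}.
  move=> x1; apply: differentiable_continuous; apply/derivable1_diffP.
  by have [] := dF x x1.
rewrite (@continuous_FTC2 _ _ F)//.
- rewrite /F -EFinB ln_div ?posrE ?pos//; last by rewrite subr_gt0.
  + by rewrite mulr1; congr EFin; ring.
  + exact: ltW.
- apply: continuous_in_subspaceT => x; rewrite inE /= in_itv /= => /andP[_ x1].
  apply: cvgV; first by rewrite gt_eqF// pos.
  apply: cvgB; [exact: cvg_cst|apply: cvgM; [exact: cvg_cst|exact: cvg_id]].
- split.
  + move=> x; rewrite in_itv /= => /andP[_ x1].
    by have [] := dF x (ltW x1).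
  + apply: cvg_at_right_filter; exact: cF (ltW t1).
  + by apply: cvg_at_left_filter; exact: cF.
- move=> x; rewrite in_itv /= => /andP[_ x1].
  rewrite derive1E; exact: (@derive_val _ _ _ _ _ _ _ (dF x (ltW x1))).
Qed.

(** The expected number of stages, the present one included, during which an
    object is kept when it is lost at the first observation above
    [max(c, m)].  [hold q 0] is the reward for stopping; for the right [c],
    [hold q c] is the value function.  The clamp to the interval from 0 to 1
    covers the values that the observations take with probability zero. *)
Definition hold (c m : R) : R := (1 - q * Num.min 1 (Num.max c m))^-1.

Lemma hold_den_gt0 c m : 0 < 1 - q * Num.min 1 (Num.max c m).
Proof.
have /andP[q0 q1] := q01.
have : Num.min 1 (Num.max c m) <= 1 by rewrite ge_min lexx.
by move=> ?; nra.
Qed.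

Lemma hold_ge0 c m : 0 <= hold c m.
Proof. by rewrite /hold invr_ge0 ltW// hold_den_gt0. Qed.

Lemma hold_le c m : hold c m <= (1 - q)^-1.
Proof.
have /andP[q0 q1] := q01.
rewrite /hold lef_pV2 ?posrE ?hold_den_gt0 ?subr_gt0//.
have : Num.min 1 (Num.max c m) <= 1 by rewrite ge_min lexx.
by move=> ?; nra.
Qed.

Lemma ler_hold c d m : c <= d -> hold c m <= hold d m.
Proof.
move=> cd; have /andP[q0 q1] := q01.
rewrite /hold lef_pV2 ?posrE ?hold_den_gt0//.
rewrite lerD2l lerN2 ler_pM2l// le_min !ge_min lexx /=.
by rewrite ge_max !le_max cd lexx !orbT.
Qed.

Lemma nondecreasing_hold c : {homo hold c : x y / x <= y}.
Proof.
move=> x y xy; have /andP[q0 q1] := q01.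
rewrite /hold lef_pV2 ?posrE ?hold_den_gt0//.
rewrite lerD2l lerN2 ler_pM2l// le_min !ge_min lexx /=.
by rewrite ge_max !le_max xy lexx !orbT.
Qed.

(** Renewal at the next stage: with probability [q] times that of an
    observation below [m], the object is kept and nothing has changed. *)
Lemma hold_renew m : hold 0 m = 1 + q * (Num.min 1 (Num.max 0 m) * hold 0 m).
Proof.
have := hold_den_gt0 0 m; rewrite /hold => /lt0r_neq0.
by move: (Num.min _ _) => t ?; field.
Qed.

Lemma measurable_hold c : measurable_fun [set: R] (hold c).
Proof.
apply: nondecreasing_measurable => // x y; exact: nondecreasing_hold.
Qed.

Lemma measurable_hold_max c :
  measurable_fun [set: R * R] (fun z => hold c (Num.max z.1 z.2)).
Proof.
apply: measurableT_comp; first exact: measurable_hold.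
exact: measurable_maxr.
Qed.

(** Below the level [t] the new observation does not change the maximum in
    [hold]; above it, the integrand is [1 / (1 - q u)]. *)
Lemma integral_uniform_hold c m : 0 <= c ->
  let t := Num.min 1 (Num.max c m) in
  (\int[uniform_prob (@ltr01 R)]_u (hold c (Num.max m u))%:E =
    (t * hold c m + q^-1 * ln ((1 - q * t) / (1 - q)))%:E)%E.
Proof.
move=> c0 t.
have t0 : 0 <= t by rewrite /t le_min ler01 le_max c0.
have t1 : t <= 1 by rewrite /t ge_min lexx.
have mh : measurable_fun [set: R] (fun u => hold c (Num.max m u)).
  by apply: measurableT_comp; [exact: measurable_hold|exact: measurable_maxr].
rewrite integral_uniform//; last 2 first.
- exact/measurable_EFinP.
- by move=> u; rewrite lee_fin hold_ge0.
rewrite subr0 invr1 mul1e.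
have -> : `[0%R, 1%R]%classic = `[0, t]%classic `|` `]t, 1%R]%classic.
  by rewrite (@itv_bndbnd_setU _ _ (BLeft 0) (BRight t) (BRight 1))// bnd_simp.
rewrite ge0_integral_setU//=; last 3 first.
- exact/measurable_EFinP/measurable_funTS.
- by move=> u _; rewrite lee_fin hold_ge0.
- rewrite disj_set2E; apply/eqP/seteqP; split => // u [] /=.
  by rewrite !in_itv /= => /andP[_ ut] /andP[tu _]; rewrite ltNge ut in tu.
rewrite EFinD; congr (_ + _)%E.
- rewrite (eq_integral (fun=> (hold c m)%:E)); last first.
    move=> u; rewrite inE /= in_itv /= => /andP[u0 ut]; congr (EFin _^-1).
    congr (1 - q * _); rewrite maxA (max_l _)//.
    by rewrite (le_trans ut)// /t ge_min lexx orbT.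
  rewrite integral_cst//= lebesgue_measure_itv /= lte_fin.
  case: ltP => [_|t0']; first by rewrite -EFinB subr0 -EFinM mulrC.
  by rewrite mule0 (_ : t = 0) ?mul0r//; apply/eqP; rewrite eq_le t0 t0'.
- move: t1; rewrite le_eqVlt => /predU1P[->|t1].
    rewrite set_itvoc0 // integral_set0 mulr1 divff ?ln1 ?mulr0//.
    by rewrite subr_eq0 gt_eqF//; case/andP: q01.
  rewrite integral_itv_obnd_cbnd; last exact/measurable_EFinP/measurable_funTS.
  rewrite -integral_inv_affine ?t0//; apply: eq_integral => u.
  rewrite inE /= in_itv /= => /andP[tu u1]; congr (EFin _^-1).
  congr (1 - q * _); rewrite maxA.
  have st : Num.max c m = t.
    by move: t1; rewrite /t gt_min ltxx /= => /ltW ?; rewrite min_r.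
  by rewrite st max_r ?min_r// ?ltW.
Qed.

(** The mean over the next observation adds
    [ln ((1 - q t) / (1 - q))] to [q t hold c m], and [hold c m] exceeds the
    latter by exactly 1; the condition on [c] makes the logarithm at most 1. *)
Lemma hold_superharmonic c m : 0 <= c <= 1 -> 1 - q * c <= expR 1 * (1 - q) ->
  (q%:E * \int[uniform_prob (@ltr01 R)]_u (hold c (Num.max m u))%:E <=
    (hold c m)%:E)%E.
Proof.
move=> /andP[c0 c1] ce; have /andP[q0 q1] := q01.
rewrite integral_uniform_hold//; set t := Num.min 1 _.
have ct : c <= t by rewrite /t le_min c1 le_max lexx.
have X0 : 0 < (1 - q * t) / (1 - q).
  by rewrite divr_gt0 ?hold_den_gt0// subr_gt0.
have lnX : ln ((1 - q * t) / (1 - q)) <= 1.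
  rewrite -[leRHS]expRK ler_ln ?posrE ?expR_gt0// ler_pdivrMr ?subr_gt0//.
  by apply: le_trans ce; rewrite lerD2l lerN2 ler_pM2l.
rewrite -EFinM lee_fin mulrDr [q * (q^-1 * _)]mulrA mulfV ?gt_eqF// mul1r.
apply: le_trans (lerD (lexx _) lnX) _.
have := hold_den_gt0 c m; rewrite /hold -/t => /lt0r_neq0 h.
by rewrite le_eqVlt; apply/orP; left; apply/eqP; field.
Qed.

(** At or below the threshold [t = c], and the logarithm is exactly 1. *)
Lemma hold_harmonic c m : 0 <= c <= 1 -> m <= c ->
  1 - q * c = expR 1 * (1 - q) ->
  (q%:E * \int[uniform_prob (@ltr01 R)]_u (hold c (Num.max m u))%:E =
    (hold c m)%:E)%E.
Proof.
move=> /andP[c0 c1] mc ce; have /andP[q0 q1] := q01.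
rewrite integral_uniform_hold//; set t := Num.min 1 _.
have tc : t = c by rewrite /t (max_l mc) min_r.
rewrite -EFinM /hold -/t tc ce; congr EFin.
have e0 : expR 1 != 0 :> R by rewrite gt_eqF// expR_gt0.
rewrite mulfK ?subr_eq0 1?eq_sym ?lt_eqF// expRK.
have := hold_den_gt0 c m; rewrite -/t tc => /lt0r_neq0 h.
by rewrite -ce; field; rewrite h gt_eqF.
Qed.

(** The mean of [hold c] at a uniform observation. *)
Definition threshold_value (c : R) : R :=
  c * hold c c + q^-1 * ln ((1 - q * c) / (1 - q)).

End calculus.

(** * The uniform law *)

Section uniform_law.
Context (R : realType).
Local Notation U := (uniform_prob (@ltr01 R)).

Lemma uniform_prob_lebesgue (A : set R) : measurable A ->
  U A = lebesgue_measure (A `&` `[0%R, 1%R]).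
Proof.
move=> mA; rewrite -[in LHS](setIT A) -integral_indic// integral_uniform//.
- by rewrite subr0 invr1 mul1e integral_indic.
- exact/measurable_EFinP/measurable_indic.
Qed.

Lemma uniform_prob_lt (y : R) :
  U [set u | u < y] = (Num.min 1 (Num.max 0 y))%:E.
Proof.
have -> : [set u | u < y] = `]-oo, y[%classic by apply/seteqP; split => u; rewrite /= in_itv.
rewrite uniform_prob_lebesgue//.
have [y0|y0] := leP y 0.
  rewrite min_r// (_ : _ `&` _ = set0) ?measure0//.
  apply/seteqP; split => // u [] /=; rewrite !in_itv /= => uy /andP[u0 _].
  by move: (le_lt_trans u0 uy); rewrite ltNge y0.
have [y1|y1] := leP y 1.
  rewrite (_ : _ `&` _ = `[0%R, y[%classic).
    by rewrite lebesgue_measure_itv /= lte_fin y0 oppr0 adde0.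
  apply/seteqP; split => u /=; rewrite !in_itv /=.
    by move=> [-> /andP[->]].
  by move=> /andP[-> uy]; rewrite uy (le_trans (ltW uy) y1).
rewrite setIidr.
  by rewrite lebesgue_measure_itv /= lte_fin ltr01 oppr0 adde0.
by move=> u /=; rewrite !in_itv /= => /andP[_ u1]; exact: le_lt_trans y1.
Qed.

Lemma uniform_prob_oo01 : U `]0%R, 1%R[ = 1%E.
Proof.
rewrite uniform_prob_lebesgue// setIidl; last by apply: subset_itv_oo_cc.
by rewrite lebesgue_measure_itv /= lte_fin ltr01 oppr0 adde0.
Qed.

End uniform_law.

Lemma measurable_RV d d' (T : measurableType d) (T' : measurableType d')
    (R : realType) (P : probability T R) (Y : {RV P >-> T'}) (B : set T') :
  measurable B -> measurable (Y @^-1` B).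
Proof. by move=> mB; rewrite -[X in measurable X]setTI; exact: measurable_funP. Qed.

Lemma ge0_integral_uniform01 d (T : measurableType d) (R : realType)
    (P : probability T R) (Y : {RV P >-> R}) (f : R -> \bar R) :
  uniform01 Y -> measurable_fun [set: R] f -> (forall u, 0 <= f u)%E ->
  (\int[P]_w f (Y w) = \int[uniform_prob (@ltr01 R)]_u f u)%E.
Proof.
move=> Y_unif mf f0.
have mY : measurable_fun [set: T] (Y : T -> measurableTypeR R).
  by move=> _ B mB; rewrite setTI; exact: measurable_RV.
pose law : {measure set (measurableTypeR R) -> \bar R} :=
  measure_function_pushforward__canonical__measure_function_Measure P mY.
transitivity (\int[law]_u f u)%E.
  by rewrite /law /= (ge0_integral_pushforward mY P measurableT mf).
by apply: eq_measure_integral => A mA _; exact: Y_unif.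
Qed.

(** * The information at a given stage *)

Section information_theory.
Context d (T : measurableType d) (R : realType) (P : probability T R).
Variables (X : nat -> {RV P >-> R}) (N : {RV P >-> nat}).

(** The generators of [information X N k]; [infoType k] is the sample space
    with this sigma-algebra, so that the closure properties of measurable sets
    and functions apply to the information. *)
Definition observable k : set (set T) :=
  (\bigcup_(i in [set i | (1 <= i <= k)%N])
     preimage_set_system setT (X i) measurable) `|`
  [set [set w | (i <= N w)%N] | i in [set i | (1 <= i <= k)%N]].

Definition infoType k : measurableType _ := g_sigma_algebraType (observable k).

Lemma information_measurable k : information X N k `<=` measurable.
Proof.
apply: smallest_sub; first exact: sigma_algebra_measurable.
move=> A [[i _ [B mB <-]]|[i _ <-]].
  by rewrite setTI; exact: measurable_RV.
exact: (@measurable_RV _ _ _ _ _ _ N [set n | (i <= n)%N]).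
Qed.

Lemma sub_information k l : (k <= l)%N -> information X N k `<=` information X N l.
Proof.
move=> kl; apply: sub_smallest2r; first exact: smallest_sigma_algebra.
move=> A [[i /= /andP[i1 ik] XA]|[i /= /andP[i1 ik] NA]].
  by left; exists i => //=; rewrite i1 (leq_trans ik).
by right; exists i => //=; rewrite i1 (leq_trans ik).
Qed.

Lemma information_X k j B : (1 <= j <= k)%N -> measurable B ->
  information X N k (X j @^-1` B).
Proof.
move=> jk mB; apply: sub_sigma_algebra; left; exists j => //.
by exists B => //; rewrite setTI.
Qed.

Lemma information_N k j : (1 <= j <= k)%N -> information X N k [set w | (j <= N w)%N].
Proof. by move=> jk; apply: sub_sigma_algebra; right; exists j. Qed.

(** [X 1] is also the value at index 0, which keeps [X 0] out of the maximum:
    for [i >= 1] this is the maximum of [X 1], ..., [X i]. *)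
Fixpoint runmax i (w : T) : R :=
  if i is j.+1 then Num.max (runmax j w) (X i w) else X 1%N w.

Lemma runmax_ge j i w : (1 <= j <= i)%N -> X j w <= runmax i w.
Proof.
elim: i => [|i ih]; first by case: j.
rewrite [(j <= _)%N]leq_eqVlt => /andP[j1 /predU1P[->|ji]] /=; first by rewrite le_max lexx orbT.
by rewrite le_max ih// j1.
Qed.

Lemma runmax_attained i w : (1 <= i)%N ->
  exists2 j, (1 <= j <= i)%N & runmax i w = X j w.
Proof.
elim: i => // -[_ _|i ih _] /=; first by exists 1%N; rewrite //= maxxx.
have [//|j /andP[j1 ji] Mj] := ih.
rewrite /= in Mj *; case: leP => _; first by exists i.+2; rewrite /= ?leqnn.
by exists j; rewrite ?Mj// j1 (leq_trans ji).
Qed.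

Lemma runmax_record k w : (1 <= k)%N ->
  (forall j, (1 <= j <= k)%N -> X j w <= X k w) -> runmax k w = X k w.
Proof.
move=> k1 Xk; apply/eqP; rewrite eq_le runmax_ge ?k1//= andbT.
by have [j jk ->] := runmax_attained w k1; exact: Xk.
Qed.

Lemma measurable_X_info k j : (1 <= j <= k)%N ->
  measurable_fun [set: infoType k] (X j : infoType k -> R).
Proof. by move=> jk _ B mB; rewrite setTI; exact: information_X. Qed.

Lemma measurable_runmax_info k i : (1 <= k)%N -> (i <= k)%N ->
  measurable_fun [set: infoType k] (runmax i : infoType k -> R).
Proof.
move=> k1; elim: i => [_|i ih ik /=]; first exact: measurable_X_info.
by apply: measurable_maxr; [exact: ih (ltnW ik)|exact: measurable_X_info].
Qed.

Lemma information_runmax k i B : (1 <= k)%N -> (i <= k)%N -> measurable B ->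
  information X N k (runmax i @^-1` B).
Proof.
by move=> k1 ik mB; rewrite -[X in information _ _ _ X]setTI; exact: measurable_runmax_info.
Qed.

Lemma information_lt_runmax k j i : (1 <= j <= k)%N -> (i <= k)%N ->
  information X N k [set w | X j w < runmax i w].
Proof.
move=> /[dup] /andP[j1 jk] j1k ik.
have mlt : measurable_fun [set: infoType k]
    (fun w : infoType k => X j w < runmax i w).
  apply: measurable_fun_ltr; first exact: measurable_X_info.
  by apply: measurable_runmax_info => //; exact: leq_trans jk.
have := mlt measurableT [set true] I; rewrite setTI.
by congr (information _ _ _ _); apply/seteqP; split => w /=.
Qed.

Lemma measurable_runmax i : measurable_fun [set: T] (runmax i).
Proof.
elim: i => [|i ih] /=; first exact: measurable_funP.
by apply: measurable_maxr => //; exact: measurable_funP.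
Qed.

(** While the process is running, the events [i <= N] with [i <= k] are
    certain, so that the observations carry all the information. *)
Lemma information_trace k A : information X N k A ->
  exists2 B, sigma_RVs [set j | (1 <= j <= k)%N] X B &
    A `&` [set w | (k <= N w)%N] = B `&` [set w | (k <= N w)%N].
Proof.
set H := sigma_RVs _ _; set E := [set w | (k <= N w)%N].
pose C := [set A | exists2 B, H B & A `&` E = B `&` E].
suff: information X N k `<=` C by exact.
move=> {A}.
have ED Z : E `\` Z = E `\` (Z `&` E) by rewrite setDIr setDv setU0.
apply: smallest_sub.
  split.
  - by exists set0 => //; exact: (@measurable0 _ (g_sigma_algebraType _)).
  - move=> A [B HB AB]; exists (~` B).
      exact: (@measurableC _ (g_sigma_algebraType _)).
    by rewrite setTD !(setIC (~` _)) -!setDE ED AB -ED.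
  - move=> F FC; have /choice[B HB] : forall n, exists B, H B /\ F n `&` E = B `&` E.
      by move=> n; have [B ? ?] := FC n; exists B.
    exists (\bigcup_n B n).
      by apply: (@bigcupT_measurable _ (g_sigma_algebraType _)) => n; case: (HB n).
    by rewrite !setI_bigcupl; apply: eq_bigcupr => n _; case: (HB n).
move=> A [[i ik XA]|[i /= /andP[i1 ik] <-]].
  by exists A => //; apply: sub_sigma_algebra; exists i.
exists setT; first exact: (@measurableT _ (g_sigma_algebraType _)).
rewrite setTI setIidr// => w /= kN; exact: leq_trans kN.
Qed.

End information_theory.

(** * Waiting for and holding an object *)

Section selection.
Context d (T : measurableType d) (R : realType) (P : probability T R).
Variables (X : nat -> {RV P >-> R}) (N : {RV P >-> nat}).
Variable tau : T -> option nat.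
Hypothesis tau_rule : selection_rule X N tau.

Local Notation alive i := [set w | (i <= N w)%N].
Local Notation M := (runmax X).
Local Notation stopped k := (tau @^-1` [set Some k]).

(** At stage [i <= N] an object has been selected and is still best. *)
Definition held i : set T := [set w | exists k, [/\ tau w = Some k,
  (k <= i <= N w)%N & forall j, (k < j <= i)%N -> X j w < X k w]].

(** At stage [i <= N] nothing has been selected, at this stage or before. *)
Definition waiting i : set T :=
  [set w | (i <= N w)%N /\ forall k, tau w = Some k -> (i < k)%N].

Lemma stopped_bounds k w : tau w = Some k -> (1 <= k <= N w)%N.
Proof. by move=> /(tau_rule.2 w k)[]. Qed.

Lemma stopped_runmax k w : tau w = Some k -> M k w = X k w.
Proof.
move=> /(tau_rule.2 w k)[/andP[k1 _] Xk]; exact: runmax_record.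
Qed.

(** The object held is the running maximum, so that the state of a held
    object does not involve the stage at which it was selected. *)
Lemma held_runmax i k w : tau w = Some k -> (k <= i)%N ->
  (forall j, (k < j <= i)%N -> X j w < X k w) -> M i w = X k w.
Proof.
move=> tk; elim: i => [|i ih].
  by rewrite leqn0 => /eqP k0; have := stopped_bounds tk; rewrite k0.
rewrite leq_eqVlt => /predU1P[<- _|ki lt_k]; first exact: stopped_runmax.
rewrite /= ih// => [|j /andP[kj ji]]; last by rewrite lt_k// kj leqW.
by rewrite max_l// ltW// lt_k// ki leqnn.
Qed.

Lemma held0 : held 0 = set0.
Proof.
apply/seteqP; split => // w [k [tk]].
by rewrite leqn0 => /andP[/eqP k0 _]; have := stopped_bounds tk; rewrite k0.
Qed.

Lemma heldS i : held i.+1 =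
  (held i `&` alive i.+1 `&` [set w | X i.+1 w < M i w]) `|` stopped i.+1.
Proof.
apply/seteqP; split => w.
  move=> [k [tk /andP[+ iN] lt_k]]; rewrite leq_eqVlt => /predU1P[<-|ki]; first by right.
  have lt_k' j : (k < j <= i)%N -> X j w < X k w.
    by move=> /andP[kj ji]; rewrite lt_k// kj leqW.
  left; split; first split => //.
    by exists k; split => //; apply/andP; split; [exact: ki|exact: ltnW].
  by rewrite /= (held_runmax tk ki lt_k') lt_k// leqnn andbT.
case=> [[[[k [tk /andP[ki iN] lt_k]] /= iN1]]|/= ti].
  rewrite (held_runmax tk)// => Xi; exists k; split => //.
    by rewrite leqW.
  move=> j /andP[kj]; rewrite leq_eqVlt => /predU1P[->//|ji].
  by rewrite lt_k// kj.
exists i.+1; split => //; first by rewrite leqnn; case/andP: (stopped_bounds ti).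
by move=> j /andP[ij ji]; have := leq_trans ij ji; rewrite ltnn.
Qed.

Lemma held_alive i : held i `<=` alive i.
Proof. by move=> w [k [_ /andP[]]]. Qed.

Lemma held_stopped_disjoint i : held i `&` stopped i.+1 = set0.
Proof.
apply/seteqP; split => // w [[k [tk /andP[ki _] _]]] /=.
by rewrite tk => -[ki1]; rewrite ki1 ltnn in ki.
Qed.

Lemma waiting0 : waiting 0 = setT.
Proof. by apply/seteqP; split => // w _; split => // k /stopped_bounds/andP[]. Qed.

Lemma waitingS i : waiting i `&` alive i.+1 = stopped i.+1 `|` waiting i.+1.
Proof.
apply/seteqP; split => w.
  move=> [[_ wt] iN]; have [ti|ti] := eqVneq (tau w) (Some i.+1); first by left.
  right; split => // k tk; rewrite ltn_neqAle wt// andbT.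
  by apply: contra_neq ti => ->.
case=> [/= ti|[iN wt]].
  have /andP[_ iN] := stopped_bounds ti; split => //; split; first exact: ltnW.
  by move=> k; rewrite ti => -[<-].
by split => //; split => [|k /wt]; exact: ltnW.
Qed.

Lemma stopped_waiting_disjoint i : stopped i.+1 `&` waiting i.+1 = set0.
Proof.
by apply/seteqP; split => // w [/= ti [_ /(_ _ ti)]]; rewrite ltnn.
Qed.

Lemma waiting_alive i : waiting i `<=` alive i.
Proof. by move=> w []. Qed.

Lemma information_stopped i : information X N i (stopped i).
Proof. exact: tau_rule.1. Qed.

Lemma information_waiting i : information X N i (waiting i).
Proof.
elim: i => [|i ih]; first by rewrite waiting0; exact: (@measurableT _ (infoType _ _ _)).
have -> : waiting i.+1 = (waiting i `&` alive i.+1) `\` stopped i.+1.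
  rewrite waitingS setDUl setDv set0U setDidl// setIC.
  exact: stopped_waiting_disjoint.
apply: (@measurableD _ (infoType X N i.+1)); last exact: information_stopped.
apply: (@measurableI _ (infoType X N i.+1)).
  by apply: sub_information ih.
by apply: information_N; rewrite /= leqnn.
Qed.

Lemma information_held i : information X N i (held i).
Proof.
elim: i => [|i ih]; first by rewrite held0; exact: (@measurable0 _ (infoType _ _ _)).
rewrite heldS; apply: (@measurableU _ (infoType X N i.+1)); last exact: information_stopped.
apply: (@measurableI _ (infoType X N i.+1));
  last by apply: information_lt_runmax; rewrite ?leqnn.
apply: (@measurableI _ (infoType X N i.+1)).
  by apply: sub_information ih.
by apply: information_N; rewrite /= leqnn.
Qed.

(** The product in the [i]-th term of the duration is the indicator that the
    object selected is still best at stage [i]. *)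
Lemma payoff_held w :
  ((payoff X N tau w)%:E = \sum_(i <oo) (\1_(held i) w)%:E)%E.
Proof.
rewrite /payoff; case tw : (tau w) => [k|]; last first.
  by rewrite eseries0// => i _ _; rewrite indicE memNset// => -[k []]; rewrite tw.
have /andP[k1 kN] := stopped_bounds tw.
have heldE i : (\1_(held i) w : R) = ((k <= i <= N w)%N &&
    all (fun j => X j w < X k w) (index_iota k.+1 i.+1))%:R.
  rewrite indicE; congr (_%:R : R); congr nat_of_bool; apply/idP/idP.
    rewrite inE => -[k' []]; rewrite tw => -[<-] -> lt_k /=.
    by apply/allP => j; rewrite mem_index_iota ltnS; exact: lt_k.
  move=> /andP[ki /allP lt_k]; rewrite inE; exists k; split => // j kj.
  by apply: lt_k; rewrite mem_index_iota ltnS.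
have held_prod i : (k <= i <= N w)%N ->
    (\1_(held i) w : R) = \prod_(k.+1 <= j < i.+1) (X j w < X k w)%R%:R.
  move=> ki; rewrite heldE ki /= -natr_prod; congr (_%:R); rewrite /index_iota.
  elim: (iota _ _) => [|j s ih]; first by rewrite big_nil.
  by rewrite big_cons -ih /=; case: (_ < _); rewrite ?mul1n ?mul0n.
(* the terms beyond N and those before the selection vanish *)
rewrite (@nneseries_split _ _ 0%N (N w).+1); last by move=> i _; rewrite lee_fin.
rewrite add0n eseries0 ?adde0; last first.
  by move=> i Ni _; rewrite heldE [(i <= _)%N]leqNgt Ni andbF.
rewrite sumEFin; congr EFin; rewrite /duration; apply/esym.
rewrite (big_cat_nat (leq0n k) (leqW kN))/= [X in X + _ = _]big1_seq ?add0r; last first.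
  move=> i /andP[_]; rewrite mem_index_iota => /andP[_ ik].
  by rewrite heldE leqNgt ik.
rewrite big_ltn ?ltnS// held_prod ?leqnn// big_geq//; congr (_ + _).
by apply: eq_big_nat => i /andP[ki iN]; rewrite held_prod// ltnW.
Qed.

End selection.

(** * Stopping at the first candidate in a region *)

Lemma ohead_filter_iota (a : pred nat) m n k :
  ohead [seq j <- iota m n | a j] = Some k <->
  [/\ (m <= k < m + n)%N, a k & forall j, (m <= j < k)%N -> ~~ a j].
Proof.
elim: n m => [|n ih] m /=.
  by split => // -[]; rewrite addn0 => /andP[/leq_ltn_trans h /h]; rewrite ltnn.
case: ifPn => am /=.
  split=> [[<-]|[/andP[mk _] _ na]].
    rewrite leqnn -addSnnS leq_addr; split => // j /andP[mj /(leq_ltn_trans mj)].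
    by rewrite ltnn.
  move: mk; rewrite leq_eqVlt => /predU1P[->//|mk].
  by have := na m; rewrite leqnn mk am => /(_ isT).
rewrite ih addSnnS; split=> -[/andP[mk kn] ak na]; split => //.
- by rewrite ltnW.
- by move=> j /andP[]; rewrite leq_eqVlt => /predU1P[<-//|mj jk]; apply: na; rewrite mj.
- rewrite kn andbT ltn_neqAle mk andbT; apply: contraTneq ak => <-; exact: am.
- by move=> j /andP[mj jk]; apply: na; rewrite ltnW.
Qed.

Section stopping.
Context d (T : measurableType d) (R : realType) (P : probability T R).
Variables (X : nat -> {RV P >-> R}) (N : {RV P >-> nat}) (S : set (nat * R)).

(** This form makes being a candidate visibly an event of the information. *)
Lemma candidate_runmax k w :
  candidate X N k w <-> (1 <= k <= N w)%N /\ runmax X k w <= X k w.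
Proof.
split=> -[/[dup] kN /andP[k1 _]] Xk; split => //.
  by rewrite (runmax_record k1 Xk).
by move=> j jk; exact: le_trans (runmax_ge X w jk) Xk.
Qed.

Definition eligible k : set T := [set w | candidate X N k w /\ S (k, X k w)].

Lemma stop_at_firstP w k : stop_at_first X N S w = Some k <->
  eligible k w /\ forall j, (1 <= j < k)%N -> ~ eligible j w.
Proof.
rewrite /stop_at_first ohead_filter_iota; split.
  move=> [_ /asboolP ek nj]; split => // j jk ej.
  by have := nj j jk; rewrite asboolT.
move=> [ek nj]; split.
- by rewrite add1n ltnS; case: ek => -[].
- exact/asboolP.
- by move=> j jk; apply/asboolP; exact: nj.
Qed.

Lemma eligible_stop j w : eligible j w ->
  exists2 k, (k <= j)%N & stop_at_first X N S w = Some k.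
Proof.
move=> ej; have [|k /asboolP ek kmin] := @ex_minnP (fun k => `[< eligible k w >]).
  by exists j; apply/asboolP.
exists k; first exact/kmin/asboolP.
apply/stop_at_firstP; split => // i /andP[_ ik] ei.
by have := kmin i (asboolT ei); rewrite leqNgt ik.
Qed.

Hypothesis measurable_region : forall k, measurable [set x | S (k, x)].

Lemma information_eligible k : information X N k (eligible k).
Proof.
have [->|k0] := posnP k.
  rewrite (_ : eligible 0 = set0); first exact: (@measurable0 _ (infoType X N 0)).
  by apply/seteqP; split => // w [[]].
have -> : eligible k = [set w | (k <= N w)%N] `&` ~` [set w | X k w < runmax X k w]
    `&` X k @^-1` [set x | S (k, x)].
  apply/seteqP; split => w.
    move=> [/candidate_runmax[/andP[_ kN] Xk] Sk]; split => //; split => //=.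
    by apply/negP; rewrite -leNgt.
  move=> [[/= kN /negP]]; rewrite -leNgt => Xk Sk; split => //.
  by apply/candidate_runmax; rewrite k0.
apply: (@measurableI _ (infoType X N k)).
  apply: (@measurableI _ (infoType X N k)).
    by apply: information_N; rewrite k0 leqnn.
  apply: (@measurableC _ (infoType X N k)).
  by apply: information_lt_runmax => //; rewrite k0 leqnn.
by apply: information_X => //; rewrite k0 leqnn.
Qed.

Lemma selection_rule_stop_at_first : selection_rule X N (stop_at_first X N S).
Proof.
split; last by move=> w k /stop_at_firstP[[]].
move=> k; have -> : stop_at_first X N S @^-1` [set Some k] =
    eligible k `&` \bigcap_(j in [set j | (1 <= j < k)%N]) ~` eligible j.
  by apply/seteqP; split => w /= /stop_at_firstP.
apply: (@measurableI _ (infoType X N k)); first exact: information_eligible.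
apply: (@bigcap_measurableType _ (infoType X N k)) => j /andP[_ jk].
apply: (@measurableC _ (infoType X N k)).
by apply: (@sub_information _ _ _ _ X N j k (ltnW jk)); exact: information_eligible.
Qed.

End stopping.

Section region.
Context d (T : measurableType d) (R : realType) (P : probability T R).
Variables (X : nat -> {RV P >-> R}) (N : {RV P >-> nat}).
Variables (S : set (nat * R)) (c : R).

Lemma waiting_stop_at_first i w j : (1 <= j <= i)%N ->
  waiting N (stop_at_first X N S) i w -> ~ eligible X N S j w.
Proof.
move=> /andP[j1 ji] [_ wt] /eligible_stop[k kj /wt].
by rewrite ltnNge (leq_trans kj ji).
Qed.

(** If some observation so far reached [c], the first one to do so was larger
    than all its predecessors, hence a candidate in the region. *)
Lemma waiting_below i w :
  (forall k x, (1 <= k)%N -> c <= x -> S (k, x)) -> (1 <= i)%N ->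
  waiting N (stop_at_first X N S) i w -> runmax X i w <= c.
Proof.
move=> Sc i1 Ww; rewrite leNgt; apply/negP => cM.
have [j /andP[j1 ji] Mj] := runmax_attained X w i1.
have ex : exists j, (1 <= j <= i)%N && (c <= X j w).
  by exists j; rewrite j1 ji -Mj ltW.
have [k /andP[ki cX] kmin] := @ex_minnP _ ex.
apply: (waiting_stop_at_first ki Ww); split; last by apply: Sc => //; case/andP: ki.
have [k1 ik] := andP ki; split; first by rewrite k1 (leq_trans ik)//; case: Ww.
move=> l /andP[l1 lk]; have [->//|lk'] := eqVneq l k.
rewrite leNgt; apply/negP => Xkl.
have := kmin l; rewrite l1 (leq_trans lk ik) (le_trans cX (ltW Xkl)) => /(_ isT).
by rewrite leqNgt ltn_neqAle lk' lk.
Qed.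

End region.

(** * The dynamics of the problem *)

Section problem.
Context d (T : measurableType d) (R : realType) (P : probability T R).
Variables (X : nat -> {RV P >-> R}) (N : {RV P >-> nat}) (p q : R).
Hypothesis p01 : 0 < p < 1.
Hypothesis qE : q = 1 - p.
Hypothesis X_unif : forall k : nat, (1 <= k)%N -> uniform01 (X k).
Hypothesis X_indep : independent_RVs [set k | (1 <= k)%N] X.
Hypothesis N_pos : forall w : T, (1 <= N w)%N.
Hypothesis N_geom : geometric_RV p N.
Hypothesis N_indep : independent_of_RVs N [set k | (1 <= k)%N] X.

Local Notation U := (uniform_prob (@ltr01 R)).
Local Notation alive i := [set w | (i <= N w)%N].
Local Notation M := (runmax X).

Let q01 : 0 < q < 1.
Proof. by rewrite qE; case/andP: p01 => p0 p1; apply/andP; split; lra. Qed.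

Lemma measurable_alive i : measurable (alive i).
Proof. exact: (@measurable_RV _ _ _ _ _ _ N [set n | (i <= n)%N]). Qed.

Lemma survival i : P (alive i.+1) = (q ^+ i)%:E.
Proof.
elim: i => [|i ih].
  rewrite (_ : [set w | _] = setT) ?probability_setT//.
  by apply/seteqP; split => // w _ /=.
(* the recursion avoids summing the tail of the geometric law *)
have split_alive : alive i.+1 = N @^-1` [set i.+1] `|` alive i.+2.
  apply/seteqP; split => w /=.
    by rewrite leq_eqVlt => /predU1P[->|?]; [left|right].
  by move=> [->//|/ltnW].
have mk k : measurable (N @^-1` [set k]) by exact: measurable_RV.
have : P (alive i.+1) = (P (N @^-1` [set i.+1]) + P (alive i.+2))%E.
  rewrite split_alive measureU//; first exact: measurable_alive.
  by apply/seteqP; split => // w [/= ->]; rewrite ltnn.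
rewrite ih N_geom//= -qE => h.
have fin : P (alive i.+2) \is a fin_num by rewrite fin_num_measure//; exact: measurable_alive.
rewrite -(fineK fin) -EFinD in h *; move: h => [h]; congr EFin.
by rewrite exprS qE; move: h; rewrite qE; lra.
Qed.

(** A pi-system that generates the sigma-algebra of the first [i]
    observations and on which independence from the next one is an instance of
    the product rule. *)
Definition past_cylinder i : set (set T) :=
  [set \bigcap_(j in [set j | (1 <= j <= i)%N]) (X j @^-1` A j) |
    A in [set A : nat -> set R | forall j, measurable (A j)]].

(** Both sides are finite measures in [D], and they agree on the cylinders. *)
Lemma past_future_indep i D B :
  sigma_RVs [set j | (1 <= j <= i)%N] X D -> measurable B ->
  P (D `&` X i.+1 @^-1` B) = (P D * P (X i.+1 @^-1` B))%E.
Proof.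
move=> HD mB; have mXB : measurable (X i.+1 @^-1` B) by exact: measurable_RV.
have fB : P (X i.+1 @^-1` B) \is a fin_num by rewrite fin_num_measure.
pose b : {nonneg R} := NngNum (fine_ge0 (measure_ge0 P (X i.+1 @^-1` B))).
have bE : b%:num%:E = P (X i.+1 @^-1` B) by rewrite /= fineK.
suff : mrestr P mXB D = mscale b P D.
  by rewrite /mscale /mrestr bE muleC.
have cyl_measurable : past_cylinder i `<=` measurable.
  by move=> _ [A mA <-]; apply: bigcap_measurableType => j _; exact: measurable_RV.
have cylT : past_cylinder i setT.
  exists (fun=> setT) => //; rewrite bigcapT//.
apply: (g_sigma_algebra_measure_unique (past_cylinder i) _ (fun=> setT)) => //.
- by rewrite bigcup_const.
- move=> _ _ [A mA <-] [A' mA' <-]; exists (fun j => A j `&` A' j).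
    by move=> j; exact: measurableI.
  by rewrite -bigcapI.
- move=> _ [A mA <-].
  rewrite /= /mrestr /mscale bE.
  (* the product rule on the indices up to i and on those up to i.+1 *)
  pose J : {fset nat} := [fset j | j in iota 1 i]%fset.
  have memJ j : (j \in J) = (1 <= j <= i)%N by rewrite !inE /= mem_iota add1n ltnS.
  have JE : [set` J] = [set j | (1 <= j <= i)%N].
    by apply/seteqP; split => j /=; rewrite memJ.
  have iJ : i.+1 \notin J by rewrite memJ ltnn andbF.
  pose A' j := if j == i.+1 then B else A j.
  have A'J j : j \in J -> A' j = A j.
    by rewrite /A'; case: eqP => // ->; rewrite (negbTE iJ).
  have J1 : [set` J] `<=` [set k | (1 <= k)%N] by rewrite JE => k /= /andP[].
  have J'1 : [set` (i.+1 |` J)%fset] `<=` [set k | (1 <= k)%N].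
    by move=> k /fset1UP[->//|]; rewrite memJ => /andP[].
  have mA' j : j \in (i.+1 |` J)%fset -> measurable (A' j).
    by move=> _; rewrite /A'; case: eqP.
  have := X_indep J'1 mA'; rewrite big_fsetU1//= {2}/A' eqxx.
  rewrite (eq_big_seq (fun j => P (X j @^-1` A j))); last first.
    by move=> j jJ; rewrite A'J.
  rewrite -(X_indep J1 (fun j _ => mA j)) JE => <-; congr (P _).
  apply/seteqP; split => w /=.
    move=> [wA wB] j /fset1UP[->|jJ]; first by rewrite /A' eqxx.
    by rewrite A'J//; apply: wA => /=; rewrite -memJ.
  move=> wA; split => [j /= jJ|].
    by have := wA j; rewrite A'J ?memJ//; apply; apply/fset1UP; right; rewrite memJ.
  by have := wA i.+1; rewrite /A' eqxx; apply; apply/fset1UP; left.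
- by move=> k; rewrite /= /mrestr setTI ltey_eq fB.
- move: D HD; apply: sub_smallest2r; first exact: smallest_sigma_algebra.
  move=> D [j ji [A mA <-]].
  exists (fun k => if k == j then A else setT); first by move=> k; case: eqP.
  rewrite setTI; apply/seteqP; split => w /=.
    by move=> /(_ j ji); rewrite eqxx.
  by move=> wA k _; case: eqP => // ->.
Qed.

Lemma sub_sigma_RVs (I J : set nat) : I `<=` J -> sigma_RVs I X `<=` sigma_RVs J X.
Proof.
move=> IJ; apply: sub_smallest2r; first exact: smallest_sigma_algebra.
by move=> A [j /IJ Jj XA]; exists j.
Qed.

(** On [D] the process has reached stage [i], so [D] is the trace of an event
    of the observations alone; the three sources of randomness, past
    observations, next observation and horizon, then separate. *)
Lemma alive_step i D B : (1 <= i)%N -> information X N i D -> D `<=` alive i ->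
  measurable B ->
  P (D `&` alive i.+1 `&` X i.+1 @^-1` B) = (q%:E * P D * U B)%E.
Proof.
move=> i1 iD Dalive mB.
have [D' HD' DD'] := information_trace iD.
have DE : D = D' `&` N @^-1` [set n | (i <= n)%N].
  by rewrite -DD' setIidl.
have HD'' : sigma_RVs [set j | (1 <= j)%N] X D'.
  by apply: sub_sigma_RVs HD' => j /= /andP[].
have HXB : sigma_RVs [set j | (1 <= j)%N] X (X i.+1 @^-1` B).
  by apply: sub_sigma_algebra; exists i.+1 => //; exists B => //; rewrite setTI.
have -> : D `&` alive i.+1 `&` X i.+1 @^-1` B =
    (D' `&` X i.+1 @^-1` B) `&` N @^-1` [set n | (i.+1 <= n)%N].
  rewrite DE setIAC -!setIA (setICA _ (X i.+1 @^-1` B)); congr (_ `&` (_ `&` _)).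
  apply/seteqP; split => w /= => [[_ ?]|?] //; split => //; exact: ltnW.
rewrite N_indep; last exact: (@measurableI _ (g_sigma_algebraType _)).
rewrite (past_future_indep HD')// DE N_indep//.
have qi : (q ^+ i)%:E = (q%:E * (q ^+ i.-1)%:E)%E by rewrite -EFinM -exprS prednK.
rewrite (survival i) -[X in (P D' * P [set w | (X <= _)%N])%E](prednK i1) survival qi.
rewrite -(X_unif (ltn0Sn i) mB) /distribution /pushforward.
rewrite -!muleA (muleCA (P (X _ @^-1` _))) (muleCA (P D')).
by rewrite [((_ ^+ _)%:E * _)%E]muleC.
Qed.

(** The Markov property of the pair formed by survival and running maximum:
    one more stage costs a factor [q] and draws a fresh uniform variable. *)
Lemma integral_step i D (phi : R * R -> \bar R) :
  (1 <= i)%N -> information X N i D -> D `<=` alive i ->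
  measurable_fun [set: R * R] phi -> (forall z, 0 <= phi z)%E ->
  (\int[P]_(w in D `&` alive i.+1) phi (runmax X i w, X i.+1 w) =
    q%:E * \int[P]_(w in D) \int[U]_u phi (runmax X i w, u))%E.
Proof.
move=> i1 iD Dalive mphi phi0.
apply: freezing => //.
- exact: information_measurable iD.
- exact: measurable_alive.
- exact: measurable_runmax.
- have := measurable_RV (X i.+1); move=> h _ B mB; rewrite setTI; exact: h.
- by rewrite qE subr_ge0 ltW//; case/andP: p01.
- move=> A B mA mB.
  rewrite setIA (setIAC D); apply: alive_step => //.
    apply: (@measurableI _ (infoType X N i)) => //.
    exact: information_runmax.
  by move=> w [/Dalive].
Qed.

Section threshold.
Variable c : R.
Hypothesis c01 : 0 <= c <= 1.
Hypothesis c_stop : 1 - q * c <= expR 1 * (1 - q).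

Section rule.
Variable tau : T -> option nat.
Hypothesis tau_rule : selection_rule X N tau.

Local Notation stopped k := (tau @^-1` [set Some k]).
Local Notation held := (held X N tau).
Local Notation waiting := (waiting N tau).
Local Notation beat i := [set w | X i.+1 w < M i w].

Let mheld i : measurable (held i).
Proof. by apply: (@information_measurable _ _ _ _ X N i); apply: information_held. Qed.

Let mwaiting i : measurable (waiting i).
Proof. by apply: (@information_measurable _ _ _ _ X N i); apply: information_waiting. Qed.

Let mstopped i : measurable (stopped i).
Proof. by apply: (@information_measurable _ _ _ _ X N i); apply: information_stopped. Qed.

Let mbeat i : measurable (beat i).
Proof.
apply: (@information_measurable _ _ _ _ X N i.+1).
by apply: information_lt_runmax; rewrite ?leqnn.
Qed.

Lemma measurable_hold_runmax b i :
  measurable_fun [set: T] (fun w => (hold q b (M i w))%:E).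
Proof.
apply/measurable_EFinP; apply: measurableT_comp; last exact: measurable_runmax.
exact: measurable_hold.
Qed.

Let hold_ge0E b i w : (0 <= (hold q b (M i w))%:E)%E.
Proof. by rewrite lee_fin hold_ge0. Qed.

(** The renewal equation [hold_renew] integrated over [held i]: the stage
    counts for one, and the object survives it when the process goes on and
    the next observation does not beat the maximum. *)
Lemma held_balance i : (1 <= i)%N ->
  (\int[P]_(w in held i) (hold q 0 (M i w))%:E =
    P (held i) +
    \int[P]_(w in held i `&` alive i.+1 `&` beat i) (hold q 0 (M i.+1 w))%:E)%E.
Proof.
move=> i1; have /andP[q0 q1] := q01.
pose B : set (R * R) := [set z | z.2 < z.1].
have mB : measurable B.
  have mlt : measurable_fun [set: R * R] (fun z : R * R => z.2 < z.1).
    exact: measurable_fun_ltr.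
  have := mlt measurableT [set true] I; rewrite setTI.
  by congr measurable; apply/seteqP; split.
(* the held object and whether the next observation z.2 leaves it best *)
pose phi (z : R * R) := (hold q 0 z.1 * \1_B z)%:E.
have mphi : measurable_fun [set: R * R] phi.
  apply/measurable_EFinP; apply: measurable_funM; last exact: measurable_indic.
  by apply: measurableT_comp => //; exact: measurable_hold.
have phi0 z : (0 <= phi z)%E by rewrite lee_fin mulr_ge0// hold_ge0.
have phiI m : (\int[U]_u phi (m, u) = (Num.min 1 (Num.max 0 m) * hold q 0 m)%:E)%E.
  transitivity (\int[U]_u ((hold q 0 m)%:E * (\1_[set u | (u < m)%R] u)%:E))%E.
    by apply: eq_integral => u _; rewrite /phi /= !indicE EFinM.
  have mlt : measurable [set u : R | u < m].
    have -> : [set u : R | u < m] = `]-oo, m[%classic.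
      by apply/seteqP; split => u; rewrite /= in_itv.
    exact: measurable_itv.
  rewrite ge0_integralZl_EFin ?hold_ge0//; last exact/measurable_EFinP/measurable_indic.
  rewrite integral_indic// setIT [in RHS]mulrC EFinM; congr (_ * _)%E.
  exact: uniform_prob_lt.
rewrite integral_mkcondr.
transitivity (P (held i) +
    \int[P]_(w in held i `&` alive i.+1) phi (M i w, X i.+1 w))%E; last first.
  congr (_ + _)%E; apply: eq_integral => w _; rewrite patchE /phi /= indicE /B.
  case: ifPn; rewrite (inE, notin_setE) /= => Xw.
    by rewrite mem_set//= mulr1 max_l// ltW.
  by rewrite memNset// mulr0.
rewrite integral_step//; last 2 first.
- by apply: information_held.
- exact: held_alive.
under [X in (_ + _ * X)%E]eq_integral do rewrite phiI.
pose r w := (Num.min 1 (Num.max 0 (M i w)) * hold q 0 (M i w))%R.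
have r0 w : (0 <= r w)%R by rewrite mulr_ge0 ?hold_ge0// le_min ler01 le_max lexx.
have mr : measurable_fun [set: T] r.
  apply: measurable_funM; last exact/measurable_EFinP/measurable_hold_runmax.
  apply: measurable_minr; first exact: measurable_cst.
  apply: measurable_maxr; first exact: measurable_cst.
  exact: measurable_runmax.
have -> : P (held i) = (\int[P]_(w in held i) 1%:E)%E by rewrite integral_cst// mul1e.
rewrite -ge0_integralZl_EFin//; last 2 first.
- by apply/measurable_EFinP/measurable_funTS.
- exact: ltW.
rewrite -ge0_integralD//; last 2 first.
- by move=> w _; rewrite -EFinM lee_fin; apply: mulr_ge0; [exact: ltW|exact: r0].
- by apply: emeasurable_funM => //; apply/measurable_EFinP/measurable_funTS.
- by apply: eq_integral => w _; rewrite /= -EFinM -EFinD -hold_renew.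
- by move=> w _; rewrite lee_fin; exact: r0.
Qed.

Local Notation renewed m :=
  (\int[U]_u (hold q c (Num.max m u))%:E)%E.

Let renewed_ge0 m : (0 <= renewed m)%E.
Proof. by apply: integral_ge0 => u _; rewrite lee_fin hold_ge0. Qed.

Let measurable_renewed i : measurable_fun [set: T] (fun w => renewed (M i w)).
Proof.
have mF := @measurable_fun_fubini_tonelli_F _ _ _ _ _ U
  (fun z : R * R => (hold q c (Num.max z.1 z.2))%:E).
apply: (measurableT_comp (mF _ _)) => //.
- by apply/measurable_EFinP; apply: measurable_hold_max.
- by move=> z; rewrite lee_fin hold_ge0.
- exact: measurable_runmax.
Qed.

Lemma waiting_step i : (1 <= i)%N ->
  (\int[P]_(w in waiting i `&` alive i.+1) (hold q c (M i.+1 w))%:E =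
    \int[P]_(w in waiting i) (q%:E * renewed (M i w)))%E.
Proof.
move=> i1; have /andP[q0 q1] := q01.
rewrite ge0_integralZl//; last 2 first.
- exact: measurable_funTS.
- by rewrite lee_fin ltW.
apply: (@integral_step i (waiting i) (fun z => (hold q c (Num.max z.1 z.2))%:E)) => //.
- by apply: information_waiting.
- exact: waiting_alive.
- by apply/measurable_EFinP; apply: measurable_hold_max.
- by move=> z; rewrite lee_fin hold_ge0.
Qed.

(** Superharmonicity of [hold q c], integrated over [waiting i]. *)
Lemma waiting_step_le i : (1 <= i)%N ->
  (\int[P]_(w in waiting i `&` alive i.+1) (hold q c (M i.+1 w))%:E <=
    \int[P]_(w in waiting i) (hold q c (M i w))%:E)%E.
Proof.
move=> i1; have /andP[q0 q1] := q01.
rewrite waiting_step//; apply: ge0_le_integral => //.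
- by move=> w _; rewrite mule_ge0// lee_fin ltW.
- by apply: emeasurable_funM => //; exact: measurable_funTS.
- exact/measurable_funTS/measurable_hold_runmax.
- by move=> w _; apply: hold_superharmonic.
Qed.

Lemma held_split i (f : T -> \bar R) : measurable_fun [set: T] f ->
  (forall w, 0 <= f w)%E ->
  (\int[P]_(w in held i.+1) f w =
    \int[P]_(w in held i `&` alive i.+1 `&` beat i) f w +
    \int[P]_(w in stopped i.+1) f w)%E.
Proof.
move=> mf f0; rewrite (heldS tau_rule) ge0_integral_setU//.
- apply: measurableI => //; apply: measurableI => //; exact: measurable_alive.
- exact: measurable_funTS.
- rewrite disj_set2E; apply/eqP; rewrite -subset0 -(held_stopped_disjoint X N tau i).
  by move=> w [[[]]].
Qed.

Lemma waiting_split i (f : T -> \bar R) : measurable_fun [set: T] f ->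
  (forall w, 0 <= f w)%E ->
  (\int[P]_(w in waiting i `&` alive i.+1) f w =
    \int[P]_(w in stopped i.+1) f w + \int[P]_(w in waiting i.+1) f w)%E.
Proof.
move=> mf f0; rewrite (waitingS tau_rule) ge0_integral_setU//.
- exact: measurable_funTS.
- by rewrite disj_set2E; apply/eqP; exact: stopped_waiting_disjoint.
Qed.

(** An upper bound for the expected payoff collected from stage [i] on:
    the value function where nothing has been selected, the exact expected
    remaining duration where an object is held. *)
Definition potential i : \bar R :=
  (\int[P]_(w in waiting i) (hold q c (M i w))%:E +
   \int[P]_(w in held i) (hold q 0 (M i w))%:E)%E.

Lemma potential_ge0 i : (0 <= potential i)%E.
Proof. by apply: adde_ge0; apply: integral_ge0 => w _. Qed.

Lemma stopped_le i :
  (\int[P]_(w in stopped i) (hold q 0 (M i w))%:E <=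
   \int[P]_(w in stopped i) (hold q c (M i w))%:E)%E.
Proof.
apply: ge0_le_integral => //.
- exact/measurable_funTS/measurable_hold_runmax.
- exact/measurable_funTS/measurable_hold_runmax.
- by move=> w _; rewrite lee_fin ler_hold//; case/andP: c01.
Qed.

(** What leaves [waiting] at stage [i.+1] enters [held], and its integrand
    changes from [hold q c] to [hold q 0], which is smaller. *)
Lemma potential_step i : (1 <= i)%N -> (P (held i) + potential i.+1 <= potential i)%E.
Proof.
move=> i1; rewrite /potential held_split//; last exact: measurable_hold_runmax.
rewrite (held_balance i1).
have := waiting_step_le i1; rewrite waiting_split//; last exact: measurable_hold_runmax.
move: (\int[_]_(_ in _ `&` _) _)%E => B sW.
rewrite [leRHS]addeC -[leRHS]addeA; apply: leeD2l; rewrite addeCA; apply: leeD2l.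
by apply: le_trans sW; rewrite addeC leeD2r// stopped_le.
Qed.

(** [M 1] is [X 1]. *)
Lemma integral_hold_first b :
  (\int[P]_w (hold q b (M 1%N w))%:E = \int[U]_u (hold q b u)%:E)%E.
Proof.
rewrite -(ge0_integral_uniform01 (X_unif (ltn0Sn 0)))//.
- by apply: eq_integral => w _; rewrite /= maxxx.
- by apply/measurable_EFinP; apply: measurable_hold.
- by move=> u; rewrite lee_fin hold_ge0.
Qed.

Lemma integral_first : (\int[U]_u (hold q c u)%:E = (threshold_value q c)%:E)%E.
Proof.
have /andP[c0 c1] := c01.
have := integral_uniform_hold q01 c c0; rewrite maxxx min_r// => <-.
by apply: eq_integral => u _; rewrite /hold maxA maxxx.
Qed.

Lemma value_split :
  ((threshold_value q c)%:E = \int[P]_(w in stopped 1%N) (hold q c (M 1%N w))%:E +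
     \int[P]_(w in waiting 1%N) (hold q c (M 1%N w))%:E)%E.
Proof.
rewrite -waiting_split//; last exact: measurable_hold_runmax.
rewrite -integral_first -integral_hold_first (waiting0 tau_rule) setTI.
congr integral; apply/seteqP; split => // w _ /=; exact: N_pos.
Qed.

Lemma potential1 : potential 1%N =
  (\int[P]_(w in waiting 1%N) (hold q c (M 1%N w))%:E +
   \int[P]_(w in stopped 1%N) (hold q 0 (M 1%N w))%:E)%E.
Proof.
rewrite /potential held_split//; last exact: measurable_hold_runmax.
by rewrite (held0 tau_rule) !set0I integral_set0 add0e.
Qed.

Lemma potential1_le : (potential 1%N <= (threshold_value q c)%:E)%E.
Proof. by rewrite potential1 value_split addeC leeD2r// stopped_le. Qed.

Lemma sum_held_potential n :
  (\sum_(0 <= i < n.+1) P (held i) + potential n.+1 <= (threshold_value q c)%:E)%E.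
Proof.
elim: n => [|n ih].
  by rewrite big_nat1 (held0 tau_rule) measure0 add0e potential1_le.
apply: le_trans ih; rewrite big_nat_recr//= -addeA leeD2l//.
exact: potential_step.
Qed.

Lemma expected_payoff_held :
  expected_payoff X N tau = (\sum_(i <oo) P (held i))%E.
Proof.
rewrite /expected_payoff unlock.
under eq_integral do rewrite (payoff_held tau_rule).
rewrite integral_nneseries//.
- by apply: eq_eseriesr => i _; rewrite integral_indic// setIT.
by move=> i; exact/measurable_EFinP/measurable_indic.
Qed.

Lemma expected_payoff_le : (expected_payoff X N tau <= (threshold_value q c)%:E)%E.
Proof.
rewrite expected_payoff_held; apply: lime_le.
  by apply: is_cvg_nneseries => i _ _; exact: measure_ge0.
apply: nearW => -[|n].
  by rewrite big_geq// (le_trans (potential_ge0 1) potential1_le).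
by apply: le_trans (sum_held_potential n); rewrite leeDl// potential_ge0.
Qed.

Section optimality.
Hypothesis selected_above : forall w k, tau w = Some k -> c <= X k w \/ c = 0.
Hypothesis rejected_below : forall i, (1 <= i)%N ->
  P (waiting i) = 0%E \/
  (1 - q * c = expR 1 * (1 - q) /\ forall w, waiting i w -> M i w <= c).

(** At or above the threshold the value function is the reward for stopping. *)
Lemma stopped_eq i :
  (\int[P]_(w in stopped i) (hold q c (M i w))%:E =
   \int[P]_(w in stopped i) (hold q 0 (M i w))%:E)%E.
Proof.
have /andP[c0 _] := c01.
apply: eq_integral => w; rewrite inE /= => ti; rewrite (stopped_runmax tau_rule ti).
case: (selected_above ti) => [cX|->//].
by rewrite /hold (max_r cX) (max_r (le_trans c0 cX)).
Qed.

Lemma waiting_step_eq i : (1 <= i)%N ->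
  (\int[P]_(w in waiting i `&` alive i.+1) (hold q c (M i.+1 w))%:E =
    \int[P]_(w in waiting i) (hold q c (M i w))%:E)%E.
Proof.
move=> i1; rewrite waiting_step//.
have [W0|[cE Mc]] := rejected_below i1.
  rewrite !null_set_integral//.
  - exact/measurable_funTS/measurable_hold_runmax.
  - by apply: emeasurable_funM => //; exact: measurable_funTS.
by apply: eq_integral => w; rewrite inE => Ww; apply: hold_harmonic => //; exact: Mc.
Qed.

Lemma potential_step_eq i : (1 <= i)%N ->
  (P (held i) + potential i.+1 = potential i)%E.
Proof.
move=> i1; rewrite /potential held_split//; last exact: measurable_hold_runmax.
rewrite (held_balance i1) -(waiting_step_eq i1) waiting_split//;
  last exact: measurable_hold_runmax.
rewrite stopped_eq; move: (\int[_]_(_ in _ `&` _) _)%E => B.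
rewrite [RHS]addeCA; congr (_ + _)%E.
by rewrite addeCA [RHS]addeC; congr (_ + _)%E; rewrite addeC.
Qed.

Lemma sum_held_potential_eq n :
  (\sum_(0 <= i < n.+1) P (held i) + potential n.+1 = (threshold_value q c)%:E)%E.
Proof.
elim: n => [|n ih].
  rewrite big_nat1 (held0 tau_rule) measure0 add0e potential1 value_split.
  by rewrite addeC stopped_eq.
by rewrite big_nat_recr//= -addeA potential_step_eq.
Qed.

(** The potential vanishes in the long run because survival does. *)
Lemma integral_hold_alive D b i : measurable D -> D `<=` alive i.+1 ->
  (\int[P]_(w in D) (hold q b (M i.+1 w))%:E <= ((1 - q)^-1 * q ^+ i)%:E)%E.
Proof.
have /andP[q0 q1] := q01.
move=> mD Dalive; apply: (@le_trans _ _ (\int[P]_(w in D) ((1 - q)^-1)%:E)%E).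
  apply: ge0_le_integral => //.
  - exact/measurable_funTS/measurable_hold_runmax.
  - by move=> w _; rewrite lee_fin hold_le.
rewrite integral_cst// EFinM lee_pmul2l//; last by rewrite lte_fin invr_gt0 subr_gt0.
rewrite -(survival i); apply: le_measure => //; rewrite inE//.
exact: measurable_alive.
Qed.

(** The sum of the [P (held i)] up to [n] falls short of the value by the
    potential at [n.+1], which is at most [2 q^n / (1 - q)]. *)
Lemma expected_payoff_eq : (expected_payoff X N tau = (threshold_value q c)%:E)%E.
Proof.
have /andP[q0 q1] := q01.
apply/eqP; rewrite eq_le expected_payoff_le /=.
rewrite expected_payoff_held; apply/lee_addgt0Pr => e e0.
(* one bound (1 - q)^-1 * q ^+ n for each of the two parts of the potential *)
pose K := (1 - q)^-1 *+ 2.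
have K0 : 0 < K by rewrite mulrn_wgt0// invr_gt0 subr_gt0.
have [n qn] : exists n, q ^+ n < e / K.
  have : (fun n => q ^+ n) @ \oo --> (0 : R) by apply: cvg_expr; rewrite ger0_norm// ltW.
  move=> /cvgrPdist_lt /(_ (e / K) (divr_gt0 e0 K0)) [n _ /(_ n (leqnn n))].
  by rewrite /= sub0r normrN ger0_norm ?exprn_ge0 ?ltW// => ?; exists n.
rewrite -(sum_held_potential_eq n); apply: leeD.
  exact: nneseries_lim_ge.
apply: (@le_trans _ _ (K * q ^+ n)%:E); last first.
  by rewrite lee_fin mulrC -ler_pdivlMr// ltW.
rewrite /K mulrnAl mulr2n EFinD; apply: leeD; apply: integral_hold_alive => //.
- exact: waiting_alive.
- exact: held_alive.
Qed.

End optimality.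

End rule.

(** One rule that attains the common upper bound is optimal and identifies the
    optimal value.  The alternatives [c = 0] and [P (waiting N tau i) = 0]
    are for the case in which every object is worth selecting. *)
Lemma optimal_rule_value tau : selection_rule X N tau ->
  (forall w k, tau w = Some k -> c <= X k w \/ c = 0) ->
  (forall i, (1 <= i)%N -> P (waiting N tau i) = 0%E \/
    (1 - q * c = expR 1 * (1 - q) /\
     forall w, waiting N tau i w -> runmax X i w <= c)) ->
  optimal_rule X N tau /\ optimal_value X N = (threshold_value q c)%:E.
Proof.
move=> tau_rule above below.
have tauE : expected_payoff X N tau = (threshold_value q c)%:E.
  exact: expected_payoff_eq.
have vE : optimal_value X N = (threshold_value q c)%:E.
  apply/eqP; rewrite eq_le; apply/andP; split.
    apply: ge_ereal_sup => _ [tau' tau'_rule <-].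
    exact: expected_payoff_le.
  by rewrite -tauE; apply: ereal_sup_ubound; exists tau.
by split => //; split => //; rewrite vE.
Qed.

End threshold.

End problem.

(** * The optimal rules *)

Theorem mainTheorem1 (R : realType) (d : measure_display)
    (T : measurableType d) (P : probability T R)
    (X : nat -> {RV P >-> R}) (N : {RV P >-> nat}) (p q x0 : R)
    (hp : 0 < p < 1) (hq : q = 1 - p)
    (hX : forall k : nat, (1 <= k)%N -> uniform01 (X k))
    (hind : independent_RVs [set k | (1 <= k)%N] X)
    (hNpos : forall w : T, (1 <= N w)%N)
    (hN : geometric_RV p N)
    (hNX : independent_of_RVs N [set k | (1 <= k)%N] X)
    (hx0 : x0 = (1 - expR 1 * p) / q) :
  (p <= (expR 1)^-1 ->
     [/\ 0 <= x0 < 1,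
         optimal_stopping_region X N
           [set s : nat * R | (1 <= s.1)%N /\ x0 <= s.2]
       & optimal_value X N =
           (x0 / (1 - q * x0) - q^-1 * ln ((1 - q) / (1 - q * x0)))%:E]) /\
  ((expR 1)^-1 < p ->
     [/\ optimal_stopping_region X N
           [set s : nat * R | (1 <= s.1)%N /\ 0 < s.2 < 1],
         optimal_rule X N (fun=> Some 1%N)
       & optimal_value X N = (- q^-1 * ln (1 - q))%:E]).
Proof.
have /andP[p0 p1] := hp.
have q0 : 0 < q by rewrite hq subr_gt0.
have pE : 1 - q = p by rewrite hq; ring.
have e0 : 0 < expR 1 :> R by exact: expR_gt0.
have e1 : 1 < expR 1 :> R by rewrite expR_gt1.
have measurable_section (Q : set R) : measurable Q ->
    forall k, measurable [set x : R | (1 <= k)%N /\ Q x].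
  move=> mQ [|k].
    by rewrite (_ : mkset _ = set0)//; apply/seteqP; split => // x [].
  by rewrite (_ : mkset _ = Q)//; apply/seteqP; split => // x [].
split => [pe|pe].
- have ep1 : expR 1 * p <= 1 by rewrite -ler_pdivlMl// mulr1.
  have x01 : 0 <= x0 < 1.
    apply/andP; split; first by rewrite hx0 divr_ge0 ?subr_ge0// ltW.
    by rewrite hx0 ltr_pdivrMr// mul1r hq ltrD2l ltrN2 ltr_pMl.
  have /andP[x00 x0lt1] := x01.
  (* at x0, stopping is worth as much as waiting for the next candidate *)
  have cE : 1 - q * x0 = expR 1 * (1 - q).
    by rewrite pE hx0 mulrCA mulfV ?gt_eqF// mulr1; ring.
  set S := [set s : nat * R | (1 <= s.1)%N /\ x0 <= s.2].
  have S_rule : selection_rule X N (stop_at_first X N S).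
    have mQ : measurable [set x : R | x0 <= x].
      by rewrite -set_itvcy; exact: measurable_itv.
    apply: selection_rule_stop_at_first => k; exact: (measurable_section _ mQ k).
  have [] := @optimal_rule_value _ _ _ _ X N p q hp hq hX hind hNpos hN hNX
    x0 _ _ _ S_rule.
  + by rewrite x00 ltW.
  + by rewrite cE.
  + by move=> w k /stop_at_firstP[[_ [_ /= x0X]] _]; left.
  + move=> i i1; right; split => // w Ww.
    by apply: waiting_below Ww => // k x k1 x0x; split.
  move=> S_opt ->; split => //; congr EFin.
  rewrite /threshold_value /hold maxxx min_r; last exact: ltW.
  congr (_ + _); rewrite -invf_div lnV ?mulrN//.
  by rewrite posrE cE pE divr_gt0// mulr_gt0.
- have ep1 : 1 - q * 0 <= expR 1 * (1 - q).
    by rewrite mulr0 subr0 pE mulrC -ler_pdivrMr// mul1r ltW.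
  have valueE : (threshold_value q 0)%:E = (- q^-1 * ln (1 - q))%:E.
    rewrite /threshold_value mul0r add0r mulr0 subr0 div1r.
    by rewrite lnV ?posrE ?pE// mulrN mulNr.
  have c01 : 0 <= (0 : R) <= 1 by rewrite lexx ler01.
  set S := [set s : nat * R | (1 <= s.1)%N /\ 0 < s.2 < 1].
  have S_rule : selection_rule X N (stop_at_first X N S).
    have mQ : measurable [set x : R | 0 < x < 1].
      by rewrite -set_itvoo; exact: measurable_itv.
    apply: selection_rule_stop_at_first => k; exact: (measurable_section _ mQ k).
  have X1 w : candidate X N 1 w.
    by split; [rewrite hNpos|move=> j; rewrite -eqn_leq => /eqP <-].
  have [] := @optimal_rule_value _ _ _ _ X N p q hp hq hX hind hNpos hN hNX
    0 c01 ep1 _ S_rule.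
  + by move=> w k _; right.
  + move=> i i1; left.
    have m01 : measurable (`]0, 1[%classic : set R) by exact: measurable_itv.
    (* the first observation is a candidate, and almost surely in the region *)
    have X1_null : P (X 1%N @^-1` (~` `]0, 1[%classic)) = 0%E.
      have /= := hX 1%N isT _ (measurableC m01).
      rewrite /distribution /pushforward => ->.
      by rewrite probability_setC// [X in (_ - X)%E]uniform_prob_oo01 subee.
    apply: subset_measure0 X1_null.
    * by apply: (@information_measurable _ _ _ _ X N i); apply: information_waiting.
    * by apply: measurable_RV; exact: measurableC.
    * move=> w Ww /=; rewrite in_itv /= => X01.
      have el1 : eligible X N S 1 w by split; [exact: X1|split].
      by apply: waiting_stop_at_first Ww el1; rewrite i1.
  move=> S_opt ->; split; [exact: S_opt| |exact: valueE].
  have one_rule : selection_rule X N (fun=> Some 1%N).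
    split=> [k|w k [<-]]; last exact: X1.
    rewrite preimage_cst; case: ifP => _.
      exact: (@measurableT _ (infoType X N k)).
    exact: (@measurable0 _ (infoType X N k)).
  have [] := @optimal_rule_value _ _ _ _ X N p q hp hq hX hind hNpos hN hNX
    0 c01 ep1 _ one_rule.
  + by move=> w k _; right.
  + move=> i i1; left; rewrite (_ : waiting _ _ _ = set0) ?measure0//.
    by apply/seteqP; split => // w [_ /(_ 1%N erefl)]; rewrite ltnNge i1.
  by move=> one_opt _; exact: one_opt.
Qed.
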